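(* Let $K,M\subset\mathbb{R}^n$ be two star bodies, let $p>0$, and let $f,g$ be two non-negative measurable functions on $\mathbb{R}^n$ such that $\|g\|_\infty=g(0)=1$. Suppose that for every $\xi\in S^{n-1}$ $$\int_K|\langle x,\xi\rangle|^p g(x)\,dx\le\int_M|\langle x,\xi\rangle|^p f(x)\,dx.$$ Then $$\left(\int_K g(x)\,dx\right)^{(n+p)/n}\le\frac{n+p}{n}\, d_{\rm ovr}(M,L_p^n)^p\,|M|^{\frac pn}\int_M f(x)\,dx.$$
   Context: A closed bounded set $K\subset\mathbb{R}^n$ is a star body if every straight line through the origin crosses the boundary of $K$ at exactly two points different from the origin, the origin is an interior point of $K$, and the Minkowski functional $\|x\|_K=\min\{a\ge 0: x\in aK\}$ is continuous on $\mathbb{R}^n$. $|K|$ denotes volume. For $p>0$, $L_p^n$ denotes the class of unit balls of $n$-dimensional subspaces of $L_p$, that is, the class of origin-symmetric convex bodies $D$ in $\mathbb{R}^n$ for which there is a finite Borel measure $\nu_D$ on $S^{n-1}$ with $\|x\|_D^p=\int_{S^{n-1}}|\langle x,\theta\rangle|^p\,d\nu_D(\theta)$ for all $x\in\mathbb{R}^n$. The outer volume ratio distance is $$d_{\rm ovr}(M,L_p^n)=\inf\left\{\left(\frac{|D|}{|M|}\right)^{1/n}: M\subset D,\ D\in L_p^n\right\}.$$ *)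

(* Defs.v *)
From HB Require Import structures.
From mathcomp Require Import all_boot all_order all_algebra.
From mathcomp Require Import all_classical all_reals all_analysis.

Set Implicit Arguments.
Unset Strict Implicit.
Unset Printing Implicit Defensive.

Import Order.TTheory GRing.Theory Num.Theory.
Import numFieldNormedType.Exports.

Local Open Scope classical_set_scope.
Local Open Scope ring_scope.

Section borel_lebesgue.
Variable R : realType.

Definition borelV n := g_sigma_algebraType (@open 'rV[R]_n).

Definition vcons n (z : measurableTypeR R * borelV n) : borelV n.+1 :=
  row_mx (z.1%:M : 'rV[R]_1) (z.2 : 'rV[R]_n).

Lemma rat_vec_near n (v : 'rV[R]_n) (e : R) : 0 < e ->
  exists w : 'rV[rat]_n, ball (map_mx ratr w : 'rV[R]_n) e v.
Proof.
move=> e0.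
have H i : exists q : rat, `|ratr q - v ord0 i| < e.
  have : v ord0 i - e < v ord0 i + e by rewrite ltrD2l gtrN.
  move=> /rat_in_itvoo[q]; rewrite in_itv/= => /andP[h1 h2].
  by exists q; rewrite ltr_distl h1 h2.
have [f Hf] := choice H.
exists (\row_i f i); split => // i j.
by rewrite !mxE (ord1 i); exact: Hf.
Qed.

Lemma measurable_vcons n : measurable_fun [set: _] (@vcons n).
Proof.
apply: (@measurability _ _ _ (borelV n.+1) setT (@vcons n)
  (@open 'rV[R]_n.+1) erefl) => _ [U oU <-]; rewrite setTI.
pose P := @vcons n @^-1` U.
pose B (t : rat * 'rV[rat]_n * nat) : set (measurableTypeR R * borelV n) :=
  (ball (ratr t.1.1 : R) t.2.+1%:R^-1) `*`
  (ball (map_mx ratr t.1.2 : 'rV[R]_n) t.2.+1%:R^-1).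
pose C (k : nat) := if unpickle k is Some t then
  (if `[< B t `<=` P >] then B t else set0) else set0.
have CE t : B t `<=` P -> C (pickle t) = B t.
  by move=> BP; rewrite /C pickleK; case: asboolP.
rewrite (_ : @preimage _ _ _ _ = \bigcup_k C k); last first.
  apply/seteqP; split => [[c v] Ucv|z [k _]]; last first.
    rewrite /C; case: unpickle => // t.
    by case: asboolP => // + Btz; exact.
  have [e /= e0 eU] : exists2 e : R, 0 < e &
      ball (vcons (c, v) : 'rV[R]_n.+1) e `<=` U.
    by move: oU; rewrite openE => /(_ _ Ucv) /nbhs_ballP[e e0 eU]; exists e.
  have [k /= ke] : exists k : nat, k.+1%:R^-1 < e / 2.
    have e2 : 0 < e / 2 by rewrite divr_gt0.
    have [k _ /(_ k)] := near_infty_natSinv_lt (PosNum e2).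
    by move=> /(_ (leqnn _)) ke; exists k.
  have k0 : (0 : R) < k.+1%:R^-1 by rewrite invr_gt0.
  have [q /= [qc]] : exists q : rat, ball (ratr q : R) k.+1%:R^-1 c /\ True.
    have : c - k.+1%:R^-1 < c + k.+1%:R^-1 by rewrite ltrD2l gtrN.
    move=> /rat_in_itvoo[q]; rewrite in_itv/= => /andP[h1 h2].
    exists q; split => //; rewrite -ball_normE /= ltr_distl.
    by rewrite h1 h2.
  move=> _; have [w [_ wv]] := rat_vec_near v k0.
  have BP : B (q, w, k) `<=` P.
    move=> [c' v'] [/= qc' [_ wv']]; apply: eU; split => // i j.
    have ee : k.+1%:R^-1 + k.+1%:R^-1 <= e :> R.
      by rewrite [e]splitr lerD // ltW.
    apply: (le_ball ee); rewrite /vcons /= !mxE; case: fintype.split => j'.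
      rewrite !mxE !ord1 eqxx !mulr1n.
      by apply: ball_triangle qc'; exact: ball_sym.
    by apply: ball_triangle (wv' _ _); exact/ball_sym/wv.
  exists (pickle (q, w, k)); first exact: I.
  by rewrite CE.
apply: bigcup_measurable => k _; rewrite /C.
case: unpickle => // t; case: asboolP => // _.
apply: measurableX; first exact: measurable_realfun.measurable_ball.
by apply: sub_sigma_algebra; exact: ball_open.
Qed.

Section lebesgue_cons.
Variables (n : nat) (mu : {measure set (borelV n) -> \bar R}).

Definition lebesgue_cons : set (borelV n.+1) -> \bar R :=
  pushforward (lebesgue_measure \x^ mu)%E (@vcons n).

Let lebesgue_cons0 : lebesgue_cons set0 = 0%E.
Proof. by rewrite /lebesgue_cons /pushforward preimage_set0 measure0. Qed.

Let lebesgue_cons_ge0 A : (0 <= lebesgue_cons A)%E.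
Proof. exact: (measure_ge0 (lebesgue_measure \x^ mu)%E). Qed.

Let lebesgue_cons_sigma_additive : semi_sigma_additive lebesgue_cons.
Proof.
rewrite /lebesgue_cons; apply: measure_semi_sigma_additive.
exact: measurable_vcons.
Qed.

HB.instance Definition _ := isMeasure.Build _ _ _ lebesgue_cons
  lebesgue_cons0 lebesgue_cons_ge0 lebesgue_cons_sigma_additive.

End lebesgue_cons.

(* n-fold product of the one-dimensional Lebesgue measure, on the Borel sets of
   R^n; see borel_lebesgue_box. *)
Fixpoint borel_lebesgue n : {measure set (borelV n) -> \bar R} :=
  if n is m.+1 then lebesgue_cons (borel_lebesgue m)
  else @dirac _ (borelV 0) 0 R.

(* R^n with the sigma-algebra of Lebesgue measurable sets (the completion of the
   Borel sigma-algebra). *)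
Definition lebesgueV n : measurableType _ :=
  caratheodory_type ((borel_lebesgue n)^*)%mu.

Definition lebesgue n : {measure set (lebesgueV n) -> \bar R} :=
  @completed_measure_extension _ _ R (borel_lebesgue n).

Lemma measurable_box n (A : 'I_n -> set R) : (forall i, closed (A i)) ->
  measurable ([set x : 'rV[R]_n | forall i, A i (x ord0 i)] : set (borelV n)).
Proof.
move=> cA; rewrite -[X in measurable X]setCK; apply: measurableC.
apply: sub_sigma_algebra; apply: closed_openC.
rewrite (_ : mkset _ = \bigcap_(i in [set: 'I_n])
    ((fun x : 'rV[R]_n => x ord0 i) @^-1` (A i))).
  apply: closed_bigI => i _.
  apply: closed_comp => // x _; exact: coord_continuous.
by apply/seteqP; split => x /= h i; [move=> _; exact: h|exact: h].
Qed.

Lemma borel_lebesgue_box n (A : 'I_n -> set R) : (forall i, closed (A i)) ->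
  borel_lebesgue n [set x : 'rV[R]_n | forall i, A i (x ord0 i)] =
  (\prod_(i < n) lebesgue_measure (A i))%E.
Proof.
elim: n A => [|n IH] A cA.
  rewrite big_ord0 /= /dirac indicE mem_set //=; by case.
rewrite big_ord_recl /= /lebesgue_cons /pushforward.
rewrite (_ : @preimage _ _ _ _ = (A ord0 : set (measurableTypeR R)) `*`
    ([set x : 'rV[R]_n | forall i, A (lift ord0 i) (x ord0 i)] : set (borelV n))).
  rewrite product_measure2E; last 2 first.
    exact: (measurable_realfun.closed_measurable (cA ord0)).
    exact: (@measurable_box n (fun i => A (lift ord0 i))).
  by congr (_ * _)%E; apply: IH.
apply/seteqP; split => [[c v] /= h|[c v] /= [h1 h2] i].
  split.
    have := h ord0; rewrite /vcons mxE.
    by case: fintype.splitP => // j _; rewrite !mxE !ord1 eqxx.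
  move=> i; have := h (lift ord0 i); rewrite /vcons mxE.
  case: fintype.splitP => [j|k] //=.
    by rewrite ord1.
  by move=> /eqP; rewrite eqSS => /eqP/val_inj->.
rewrite /vcons mxE; case: fintype.splitP => j /= ij.
  by rewrite !mxE !ord1 eqxx (_ : i = ord0) //;
    apply: val_inj; rewrite /= ij ord1.
by rewrite (_ : i = lift ord0 j) //; apply: val_inj.
Qed.

Lemma lebesgue_borelE n (A : set (borelV n)) : measurable A ->
  lebesgue n A = borel_lebesgue n A.
Proof. by move=> mA; exact: (measurable_mu_extE (borel_lebesgue n)). Qed.

End borel_lebesgue.

Section convex_geometry.
Variables (R : realType) (n : nat).
Implicit Types (K M D : set 'rV[R]_n) (x y u : 'rV[R]_n) (p : R).

Definition dot x y : R := \sum_(i < n) x ord0 i * y ord0 i.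

(* The library norm on 'rV[R]_n is the sup norm, so the Euclidean sphere is
   described through the inner product. *)
Definition sphere : set 'rV[R]_n := [set x | dot x x = 1].

Definition boundary K : set 'rV[R]_n := closure K `\` interior K.

(* min {a >= 0 : x \in a K}; the minimum is attained when K is closed, bounded
   and contains a neighbourhood of the origin. *)
Definition minkowski_functional K x : R :=
  inf [set a | 0 <= a /\ [set a *: y | y in K] x].

Definition star_body K :=
  [/\ closed K /\ bounded_set K,
      forall u, u != 0 -> exists x y, x != y /\
        (boundary K `&` range (fun t : R => t *: u)) `\ 0 = [set x; y],
      interior K 0 &
      continuous (minkowski_functional K)].

Definition convex_body D := [/\ compact D, convex_set D & interior D !=set0].

Definition origin_symmetric D := forall x, D x -> D (- x).

(* A finite Borel measure on the sphere is represented by a finite Borel measure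
   on R^n concentrated on the sphere. *)
Definition Lp_ball p D :=
  [/\ origin_symmetric D, convex_body D &
      exists2 nu : {finite_measure set (borelV R n) -> \bar R},
        nu (~` sphere) = 0%E &
        forall x, (minkowski_functional D x `^ p)%:E =
                  (\int[nu]_(theta in sphere) (`|dot x theta| `^ p)%:E)%E].

(* Valued in \bar R, so that the infimum of the empty set is +oo. *)
Definition d_ovr M p : \bar R :=
  ereal_inf [set ((lebesgue R n D / lebesgue R n M) `^ n%:R^-1)%E
            | D in [set D | M `<=` D /\ Lp_ball p D]].

End convex_geometry.

(* Main.v *)
From HB Require Import structures.
Require Import Defs.
From mathcomp Require Import all_boot all_order all_algebra.
From mathcomp Require Import all_classical all_reals all_analysis.
From mathcomp Require Import measurable_realfun ess_sup_inf ring lra.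

Set Implicit Arguments.
Unset Strict Implicit.
Unset Printing Implicit Defensive.

Import Order.TTheory GRing.Theory Num.Theory.
Import numFieldNormedType.Exports.

Local Open Scope classical_set_scope.
Local Open Scope ring_scope.

(** Fix a body [D] of the class with [M `<=` D], let [N] be its gauge and [nu]
the measure on the sphere that represents [N ^ p].  Integrating the hypothesis
over the sphere against [nu] and exchanging integrals gives
[int_K N^p g <= int_M N^p f], and the right-hand side is at most [int_M f]
because [N <= 1] on [M] ([weighted_moment_le]).

The left-hand side is bounded below by a bathtub argument.  Among all densities
[0 <= g <= 1] of given mass [J], the integral of [N^p g] is smallest when [g] is
the indicator of the dilate of [D] of volume [J].  The layer-cake formula makes
this quantitative: for every [t > 0],
  [t J <= int_K N^p g + int_0^t |{N^p < s}| ds],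
since [t <= N(x)^p + |{s in [0, t] : N(x)^p < s}|] pointwise
([layer_cake_lower_bound]).  The set [{N < r}] lies in [r D], so
[|{N^p < s}| <= |D| s^(n/p)] ([lebesgue_sublevel_le]), because Lebesgue measure
on R^n scales by [c^n] under the dilation by [c] ([borel_lebesgue_dilation]).
The choice [t = (J / |D|)^(p/n)], for which the
last bound is [J] at [s = t], yields
  [J^((n+p)/n) <= (n+p)/n |D|^(p/n) int_M f]   ([Lp_ball_bound]),
and the theorem is the infimum of these inequalities over [D].

In the extended reals, where [0 * +oo = 0], taking the infimum is not immediate
when [int_M f] is [0] or [+oo].  If it is [0], the hypothesis in a single
coordinate direction already forces [int_K g = 0]
([integral_eq0_of_coord_moment]); if it is [+oo], the right-hand side is [+oo]
because [d_ovr M p >= 1]. *)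

(** * Cubes and dilations for Lebesgue measure *)

(** The set function [pushforward m f] is a measure only when [f] is measurable;
bundling that proof allows the image measure to be scaled and integrated
against. *)
Definition pushforward_measure d d' (T1 : measurableType d)
    (T2 : measurableType d') (R : realType) (m : {measure set T1 -> \bar R})
    (f : T1 -> T2) (mf : measurable_fun setT f) : {measure set T2 -> \bar R} :=
  measure_function_pushforward__canonical__measure_function_Measure m mf.

Section cubes_and_dilations.
Context {R : realType}.

Definition cube n (r : R) : set 'rV[R]_n :=
  [set x | forall i, `[- r, r]%classic (x ord0 i)].
Arguments cube n r : clear implicits.

Lemma measurable_cube n r : measurable (cube n r : set (borelV R n)).
Proof.
apply: (@measurable_box R n (fun=> `[- r, r]%classic)) => _; exact: itv_closed.
Qed.

Lemma borel_lebesgue_cube n (r : R) : 0 <= r ->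
  borel_lebesgue R n (cube n r) = ((2 * r) ^+ n)%:E.
Proof.
move=> r0.
rewrite (@borel_lebesgue_box R n (fun=> `[- r, r]%classic)); last first.
  by move=> _; exact: itv_closed.
have -> : lebesgue_measure (`[- r, r]%classic : set R) = (2 * r)%:E.
  rewrite lebesgue_measure_itv/= lte_fin; case: ltP => h.
    by rewrite -EFinB opprK mulr_natl mulr2n.
  have -> : r = 0 by lra.
  by rewrite mulr0.
by rewrite prodEFin prodr_const card_ord.
Qed.

Lemma bounded_sub_cube n (A : set 'rV[R]_n) : bounded_set A ->
  exists2 r, 0 <= r & A `<=` cube n r.
Proof.
move=> /(@ex_strict_bound_gt0 _ _ _ _ _ _)[M M0 AM]; exists M; first exact: ltW.
move=> x /AM /= xM i; rewrite /= in_itv/= -ler_norml.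
apply: le_trans (ltW xM); rewrite [leRHS]/Num.norm /= mx_normrE.
by apply/bigmax_geP; right => /=; exists (ord0, i).
Qed.

Lemma in_nat_cube n (x : 'rV[R]_n) : exists k : nat, cube n k%:R x.
Proof.
have [r r0 xr] := @bounded_sub_cube n [set x]
  (compact_bounded (@compact_set1 _ _)).
exists (Num.truncn r).+1 => i /=.
have := xr _ erefl i; rewrite /= !in_itv/= => /andP[h1 h2].
have := truncnS_gt r; lra.
Qed.

Lemma borel_lebesgue_sigma_finite n : sigma_finite setT (borel_lebesgue R n).
Proof.
exists (fun k => cube n k%:R).
  by apply/seteqP; split => // x _; have [k xk] := in_nat_cube x; exists k.
move=> k; split; first exact: measurable_cube.
by rewrite borel_lebesgue_cube// ltry.
Qed.

(** A measure on the line is determined by its values on half-open intervals,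
and both sides are measures in [A]. *)
Lemma lebesgue_measure_dilation (c : R) (A : set (measurableTypeR R)) : 0 < c ->
  measurable A ->
  (c%:E * lebesgue_measure (( *%R c : _ -> measurableTypeR R) @^-1` A) =
   lebesgue_measure A)%E.
Proof.
move=> c0 mA.
have mc : measurable_fun setT ( *%R c : measurableTypeR R -> measurableTypeR R).
  exact: mulrl_measurable.
transitivity (mscale (NngNum (ltW c0))
    (pushforward_measure lebesgue_measure mc) A); first by [].
apply/esym; apply: lebesgue_measure_unique => //=.
move=> _ [[a b] _ <-] /=; rewrite /mscale /= /pushforward /=.
rewrite (_ : _ @^-1` _ = `]a / c, b / c]%classic); last first.
  apply/seteqP; split => x /=;
    by rewrite !in_itv/= ltr_pdivrMr// ler_pdivlMr// ![x * c]mulrC.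
rewrite !lebesgue_measure_itv/= !lte_fin ltr_pM2r ?invr_gt0//.
case: ifP => _; last by rewrite mule0.
by rewrite -!EFinD -EFinM -mulrBl mulrCA divff ?mulr1// gt_eqF.
Qed.

Lemma continuous_borel_measurable n m (h : borelV R n -> borelV R m) :
  continuous (h : 'rV[R]_n -> 'rV[R]_m) -> measurable_fun setT h.
Proof.
move=> ch; apply: (@measurability _ _ (borelV R n) (borelV R m) setT h
  (@open 'rV[R]_m) erefl) => _ [U oU <-]; rewrite setTI.
by apply: sub_sigma_algebra; apply: open_comp => // x _; exact: ch.
Qed.

Lemma measurable_scale n (c : R) :
  measurable_fun setT (( *:%R c) : borelV R n -> borelV R n).
Proof. by apply: continuous_borel_measurable; exact: scaler_continuous. Qed.

(** By induction on the dimension.  The section of the preimage of [A] at [v] is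
the preimage of the section of [A] at [c *: v]: the first coordinate contributes
one factor [c], and the change of variable [v |-> c *: v] in the integral of the
sections contributes [c ^+ n] by the induction hypothesis. *)
Lemma borel_lebesgue_dilation n (c : R) (A : set (borelV R n)) : 0 < c ->
  measurable A ->
  ((c ^+ n)%:E * borel_lebesgue R n (( *:%R c) @^-1` A) =
   borel_lebesgue R n A)%E.
Proof.
move=> c0; elim: n A => [|n IH] A mA.
  rewrite expr0 mul1e /= /dirac !indicE.
  have e : c *: (0 : borelV R 0) = 0 by exact: scaler0.
  by congr ((nat_of_bool _)%:R%:E); apply/idP/idP; rewrite !inE/= e.
rewrite /= /lebesgue_cons /pushforward /product_measure2.
pose B : set (measurableTypeR R * borelV R n) := @vcons R n @^-1` A.
have mB : measurable B by rewrite -[B]setTI; exact: measurable_vcons.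
pose G (v : borelV R n) : \bar R := lebesgue_measure (ysection B v).
have mG : measurable_fun setT G by exact: measurable_fun_ysection.
have cn0 : 0 <= c ^+ n by rewrite exprn_ge0// ltW.
have vcE z v : vcons (c * z, c *: v : borelV R n) =
    c *: (vcons (z, v) : 'rV[R]_n.+1).
  rewrite /vcons/=; apply/rowP => i; rewrite !mxE.
  by case: fintype.splitP => j _; rewrite !mxE// mulrnAr.
transitivity ((c ^+ n)%:E * \int[borel_lebesgue R n]_v G (c *: v))%E;
  last first.
  rewrite -[X in (_ * X)%E](@ge0_integral_pushforward _ _ _ _ _ _
    (@measurable_scale n c) (borel_lebesgue R n) setT G)//=.
  have G0 v : setT v -> (0 <= G v)%E by move=> _; exact: measure_ge0.
  have /esym e := @ge0_integral_mscale _ _ _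
    (pushforward_measure (borel_lebesgue R n) (@measurable_scale n c))
    setT measurableT (NngNum cn0) G mG G0.
  apply: (etrans e).
  by apply: eq_measure_integral => /= C mC _; exact: IH.
rewrite exprS EFinM -muleA muleCA -ge0_integralZl//.
- congr (_ * _)%E; apply: eq_integral => v _ /=.
  have mS : measurable (ysection B (c *: v)) by exact: measurable_ysection.
  rewrite /G -(lebesgue_measure_dilation c0 mS).
  congr (_ * lebesgue_measure _)%E.
  apply/seteqP; split => z /=; rewrite /ysection /= !inE /B /=.
    by move=> h; have := vcE z v; rewrite /= => ->.
  by move=> h; have := vcE z v; rewrite /= => <-.
- apply: measurable_fun_ysection.
  rewrite -[X in measurable X]setTI; apply: measurable_vcons => //.
  by rewrite -[X in measurable X]setTI; apply: measurable_scale.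
- by rewrite lee_fin ltW.
Qed.
End cubes_and_dilations.
Arguments cube {R} n r.

(** * A layer-cake form of the bathtub principle *)

Lemma measurable_bool_set d (T : measurableType d) (h : T -> bool) :
  measurable_fun setT h -> measurable [set x | h x].
Proof.
by move=> mh; rewrite -[X in measurable X]setTI -preimage_true; exact: mh.
Qed.

Section layer_cake_bound.
Context {R : realType}.

Lemma powR_cvg_at_right0 (a : R) :
  0 < a -> s `^ a @[s --> 0^'+] --> (0 `^ a : R).
Proof. by move=> a0; rewrite powR0 ?gt_eqF//; exact: powR_cvg0. Qed.

Lemma powR_cvg_at (a x : R) : 0 < x -> s `^ a @[s --> x] --> x `^ a.
Proof.
move=> x0.
suff: {for x, continuous (fun s : R => s `^ a)} by [].
apply: differentiable_continuous; apply/derivable1_diffP.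
by apply: derivable_powR; rewrite in_itv/= x0.
Qed.

Lemma integral_powR (a r : R) : 0 < a -> 0 < r ->
  (\int[lebesgue_measure]_(s in `[0%R, r]) (s `^ a)%:E =
   (r `^ (a + 1) / (a + 1))%:E)%E.
Proof.
move=> a0 r0; have a10 : 0 < a + 1 by rewrite addr_gt0.
pose F (s : R) := (a + 1)^-1 * s `^ (a + 1).
rewrite (@continuous_FTC2 _ _ F)//.
- by rewrite /F powR0 ?gt_eqF// mulr0 sube0 mulrC.
- apply/continuous_within_itvP => //; split.
  + by move=> x; rewrite in_itv/= => /andP[x0 _]; exact: powR_cvg_at.
  + exact: powR_cvg_at_right0.
  + by apply: cvg_at_left_filter; exact: powR_cvg_at.
- split.
  + move=> x; rewrite in_itv/= => /andP[x0 _]; apply: derivableM => //.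
    by apply: derivable_powR; rewrite in_itv/= x0.
  + by apply: cvgMr; exact: powR_cvg_at_right0.
  + by apply: cvgMr; apply: cvg_at_left_filter; exact: powR_cvg_at.
- move=> x; rewrite in_itv/= => /andP[x0 _].
  rewrite derive1E deriveM//; last first.
    by apply: derivable_powR; rewrite in_itv/= x0.
  rewrite derive_cst scaler0 addr0 -derive1E powR_derive1 ?in_itv/= ?x0//.
  by rewrite addrK /GRing.scale/= mulrA mulVf ?mul1r// gt_eqF.
Qed.

Section layer_cake.
Context d (T : measurableType d) (mu : {sigma_finite_measure set T -> \bar R}).
Variables (phi g : T -> R) (K : set T) (V a t : R).
Hypotheses (mphi : measurable_fun setT phi) (mg : measurable_fun setT g)
  (mK : measurable K) (phi0 : forall x, 0 <= phi x) (g0 : forall x, 0 <= g x)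
  (g1 : {ae mu, forall x, g x <= 1}) (V0 : 0 <= V) (a0 : 0 < a) (t0 : 0 < t).
Hypothesis muphi : forall s, 0 < s ->
  (mu [set x | (phi x < s)%R] <= (V * s `^ a)%:E)%E.

(** Above [x], the set [E] is the interval ]phi x, t]; at height [s <= t], it
is the sublevel set {phi < s}.  Measuring [E] in these two orders is the
layer-cake formula for the positive part of [t - phi]. *)
Let E : set (T * measurableTypeR R) := [set z | phi z.1 < z.2 <= t].

Let mE : measurable E.
Proof.
apply: measurable_bool_set.
apply: measurable_and; first apply: measurable_fun_ltr => //.
  exact: measurableT_comp.
exact: measurable_fun_ler.
Qed.

Let H (x : T) : \bar R := (\int[lebesgue_measure]_s (\1_E (x, s))%:E)%E.

Let HE x : H x = (Num.max 0 (t - phi x))%:E.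
Proof.
rewrite /H (_ : (fun s => _) =
    (fun s => (\1_(`]phi x, t]%classic : set R) s)%:E)); last first.
  apply/funext => s; rewrite !indicE.
  have -> // : ((x, s) \in E) = (s \in (`]phi x, t]%classic : set R)).
  by apply/idP/idP; rewrite !inE /E /= in_itv.
rewrite integral_indic//= setIT lebesgue_measure_itv/= lte_fin.
case: ltP => h; rewrite -?EFinB; congr (_%:E);
  by rewrite /Num.max; case: ltP => //; lra.
Qed.

Let mindE : measurable_fun setT (fun z => (\1_E z)%:E : \bar R).
Proof. by apply/measurable_EFinP; exact: measurable_indic. Qed.

Let mH : measurable_fun setT H.
Proof.
apply: (measurable_fun_fubini_tonelli_F (EFin \o \1_E)) => [//|x].
by rewrite lee_fin.
Qed.

Let mEs s : measurable (ysection E s).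
Proof. exact: measurable_ysection. Qed.

Let mphis s : measurable [set x | phi x < s].
Proof. by apply: measurable_bool_set; exact: measurable_fun_ltr. Qed.

Let Ele0 s : s <= 0 -> (\int[mu]_x (\1_E (x, s))%:E = 0)%E.
Proof.
move=> s0; rewrite integral0_eq// => x _.
rewrite indicE memNset//= => /andP[+ _].
by have := phi0 x; rewrite /=; lra.
Qed.

Let intH : (\int[mu]_x H x <= (V * (t `^ (a + 1) / (a + 1)))%:E)%E.
Proof.
rewrite /H (fubini_tonelli (EFin \o \1_E))//=.
apply: (@le_trans _ _
    (\int[lebesgue_measure]_(s in `[0%R, t]) (V * (s `^ a))%:E)%E).
  rewrite [leRHS]integral_mkcond; apply: ge0_le_integral => //.
  - by move=> s _; apply: integral_ge0 => x _; rewrite lee_fin.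
  - apply: (measurable_fun_fubini_tonelli_G (EFin \o \1_E)) => [//|x].
    by rewrite lee_fin.
  - apply/(measurable_restrictT _ _).1 => //; apply/measurable_EFinP.
    apply: measurable_funM => //.
    by apply: measurable_funTS; exact: measurable_powR.
  move=> s _; rewrite patchE; case: ifPn.
    rewrite inE/= in_itv/= => /andP[s0 st].
    have [sgt0|sle0] := ltP 0 s; last first.
      by rewrite Ele0// lee_fin mulr_ge0// powR_ge0.
    rewrite (_ : (fun x => _) =
        (fun x => (\1_(ysection E s) x)%:E)); last first.
      by apply/funext => x; rewrite !indicE mem_ysection.
    apply: le_trans (muphi sgt0); rewrite integral_indic//.
    rewrite setIT; apply: le_measure; rewrite ?inE; [exact: mEs|exact: mphis|].
    by move=> x /ysectionP/andP[].
  rewrite notin_setE/= in_itv/= => /negP.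
  rewrite negb_and -!ltNge => /orP[s0|ts].
    by rewrite Ele0// ltW.
  rewrite integral0_eq// => x _; rewrite indicE memNset//= => /andP[_] /=; lra.
under eq_integral do rewrite EFinM.
rewrite ge0_integralZl//.
- by rewrite integral_powR// -EFinM.
- by apply/measurable_EFinP; apply: measurable_funTS; exact: measurable_powR.
- by move=> s _; rewrite lee_fin powR_ge0.
Qed.

(** Pointwise [t <= phi + (t - phi)^+].  Integrate this against [g] over [K]:
in the second term [g] can be replaced by 1 and [K] by the whole space, and the
layer-cake formula bounds what remains by the integral of [V * s ^ a] over
[0, t].  These steps lose nothing when [g] is the indicator of {phi < t}, [K]
contains that set and the bounds on the sublevel sets are equalities. *)
Lemma layer_cake_lower_bound :
  (t%:E * \int[mu]_(x in K) (g x)%:E <=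
   \int[mu]_(x in K) (phi x * g x)%:E + (V * (t `^ (a + 1) / (a + 1)))%:E)%E.
Proof.
have mK0 (h : T -> \bar R) : measurable_fun setT h -> measurable_fun K h.
  exact: measurable_funTS.
have H0 x : (0 <= H x)%E by apply: integral_ge0 => s _; rewrite lee_fin.
have mEg : measurable_fun setT (EFin \o g) by exact/measurable_EFinP.
have mpg : measurable_fun setT (fun x => (phi x * g x)%:E).
  by apply/measurable_EFinP; exact: measurable_funM.
have mHg : measurable_fun setT (fun x => (H x * (g x)%:E)%E).
  exact: emeasurable_funM.
rewrite -ge0_integralZl//; last 3 first.
- exact: mK0.
- by move=> x _; rewrite lee_fin.
- by rewrite lee_fin ltW.
apply: (@le_trans _ _
    (\int[mu]_(x in K) ((phi x * g x)%:E + H x * (g x)%:E))%E).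
  apply: ge0_le_integral => //.
  - by move=> x _; rewrite mule_ge0 ?lee_fin// ltW.
  - by apply: mK0; exact: measurable_funeM.
  - by apply: mK0; exact: emeasurable_funD.
  move=> x _; rewrite HE -!EFinM -EFinD lee_fin -mulrDl ler_wpM2r//.
  by rewrite /Num.max; case: ltP; have := phi0 x; lra.
rewrite ge0_integralD//; last 4 first.
- by move=> x _; rewrite lee_fin mulr_ge0.
- exact: mK0.
- by move=> x _; rewrite mule_ge0 ?lee_fin.
- exact: mK0.
rewrite leeD2l//; apply: le_trans intH.
apply: (@le_trans _ _ (\int[mu]_(x in K) H x)%E).
  apply: ae_ge0_le_integral => //.
  - by move=> x _; rewrite mule_ge0 ?lee_fin.
  - exact: mK0.
  - exact: mK0.
  apply: filterS g1 => x g1x _.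
  by rewrite HE -EFinM lee_fin ler_piMr// le_max lexx.
by apply: ge0_subset_integral.
Qed.

End layer_cake.
End layer_cake_bound.

(** * Exchanging the moments with the representing measure *)

Section sigma_finite_copy.
Context d (T : measurableType d) (R : realType).
Variable mu : {measure set T -> \bar R}.

(** A synonym of [mu] that carries the proof of sigma-finiteness, as Tonelli's
theorem expects a bundled sigma-finite measure. *)
Definition sigma_finite_copy of sigma_finite setT mu : set T -> \bar R := mu.

Hypothesis mu_sf : sigma_finite setT mu.

HB.instance Definition _ := Measure.on (sigma_finite_copy mu_sf).
HB.instance Definition _ :=
  @Measure_isSigmaFinite.Build _ _ _ (sigma_finite_copy mu_sf) mu_sf.

End sigma_finite_copy.

Section moment_exchange.
Context {R : realType}.

Lemma measurable_borel_lebesgueV n (A : set (borelV R n)) :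
  measurable A -> measurable (A : set (lebesgueV R n)).
Proof. by move=> mA; apply: sub_caratheodory; exact: sub_sigma_algebra. Qed.

Lemma measurable_lebesgueV_borel n :
  measurable_fun setT (id : lebesgueV R n -> borelV R n).
Proof. by move=> _ A mA; rewrite setTI; exact: measurable_borel_lebesgueV. Qed.

Lemma lebesgue_sigma_finite n : sigma_finite setT (lebesgue R n).
Proof.
exact/completed_measure_extension_sigma_finite/borel_lebesgue_sigma_finite.
Qed.

Definition sigma_finite_lebesgue n :
    {sigma_finite_measure set (lebesgueV R n) -> \bar R} :=
  sigma_finite_copy (@lebesgue_sigma_finite n).

Lemma measurable_coord n (i : 'I_n) :
  measurable_fun setT (fun x : borelV R n => (x : 'rV[R]_n) ord0 i).
Proof.
apply: (@measurability _ _ (borelV R n) (measurableTypeR R) _ _ _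
  (RGenOpens.measurableE R)) => _ [_ [a [b ->]] <-]; rewrite setTI.
apply: sub_sigma_algebra; apply: open_comp; last exact: interval_open.
by move=> x _; exact: coord_continuous.
Qed.

Lemma measurable_dot n :
  measurable_fun setT (fun z : lebesgueV R n * borelV R n => dot z.1 z.2).
Proof.
rewrite /dot; apply: measurable_sum => i; apply: measurable_funM.
  apply: (measurableT_comp (measurable_coord i)).
  exact: (measurableT_comp (@measurable_lebesgueV_borel n) measurable_fst).
exact: (measurableT_comp (measurable_coord i)).
Qed.

Lemma measurable_sphere n : measurable (@sphere R n : set (borelV R n)).
Proof.
have md : measurable_fun setT (fun x : borelV R n => dot x x).
  rewrite /dot; apply: measurable_sum => i.
  by apply: measurable_funM; exact: measurable_coord.
rewrite -[X in measurable X]setTI; exact: (md measurableT [set 1]).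
Qed.

Section moments.
Variables (n : nat) (p : R) (nu : {finite_measure set (borelV R n) -> \bar R}).
Variable N : 'rV[R]_n -> R.
Hypothesis N0 : forall x, 0 <= N x.
Hypothesis NE : forall x, ((N x `^ p)%:E =
  \int[nu]_(theta in @sphere R n) (`|dot x theta| `^ p)%:E)%E.

Let measurable_kernel (h : lebesgueV R n -> R) : measurable_fun setT h ->
  measurable_fun setT (fun z : lebesgueV R n * borelV R n =>
    (`|dot z.1 z.2| `^ p * h z.1)%:E).
Proof.
move=> mh; apply/measurable_EFinP; apply: measurable_funM.
  apply: (measurableT_comp (measurable_powR _)).
  by apply: (measurableT_comp (@normr_measurable _ _)); exact: measurable_dot.
exact: (measurableT_comp mh measurable_fst).
Qed.

Section fix_weight.
Variables (h : lebesgueV R n -> R) (A : set (lebesgueV R n)).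
Hypotheses (mh : measurable_fun setT h) (h0 : forall x, 0 <= h x).
Hypothesis mA : measurable A.

(** Both integrals of the exchange range over a product of subsets; extending
the integrand by 0 reduces it to Tonelli's theorem on the whole product. *)
Let k : lebesgueV R n * borelV R n -> \bar R :=
  (fun z => (`|dot z.1 z.2| `^ p * h z.1)%:E) \_ (A `*` @sphere R n).

Let mk : measurable_fun setT k.
Proof.
have mAS : measurable (A `*` (@sphere R n : set (borelV R n))).
  by apply: measurableX => //; exact: measurable_sphere.
apply/(measurable_restrictT _ mAS).
by apply: measurable_funTS; exact: measurable_kernel.
Qed.

Let k0 z : (0 <= k z)%E.
Proof.
rewrite /k patchE; case: ifPn => // _.
by rewrite lee_fin mulr_ge0// powR_ge0.
Qed.

Let kF x : (\int[nu]_theta k (x, theta) =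
  ((fun x => (N x `^ p * h x)%:E) \_ A) x)%E.
Proof.
rewrite patchE; case: ifPn => xA.
  rewrite EFinM NE -ge0_integralZr//; last 3 first.
  - exact: measurable_sphere.
  - apply/measurable_EFinP/measurable_funTS.
    apply: (measurableT_comp (measurable_powR _)).
    apply: (measurableT_comp (@normr_measurable _ _)).
    exact: (measurableT_comp (@measurable_dot n)
      (pair1_measurable (x : lebesgueV R n))).
  - by rewrite lee_fin.
  rewrite [RHS]integral_mkcond; apply: eq_integral => t _.
  by rewrite /k !patchE/= in_setX xA /=; case: ifPn.
rewrite integral0_eq// => t _; rewrite /k patchE in_setX (negbTE xA)//.
Qed.

Let kG theta : (\int[lebesgue R n]_x k (x, theta) =
  ((fun t => \int[lebesgue R n]_(x in A) (`|dot x t| `^ p * h x)%:E)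
    \_ (@sphere R n)) theta)%E.
Proof.
rewrite patchE; case: ifPn => tS.
  rewrite [RHS]integral_mkcond; apply: eq_integral => x _.
  by rewrite /k !patchE/= in_setX tS andbT.
by rewrite integral0_eq// => x _; rewrite /k patchE in_setX (negbTE tS) andbF.
Qed.

Lemma integral_pow_norm_exchange :
  (\int[lebesgue R n]_(x in A) (N x `^ p * h x)%:E =
   \int[nu]_(theta in @sphere R n)
     \int[lebesgue R n]_(x in A) (`|dot x theta| `^ p * h x)%:E)%E.
Proof.
rewrite [LHS]integral_mkcond [RHS]integral_mkcond.
rewrite -(eq_integral _ _ (fun x _ => kF x)).
rewrite -(eq_integral _ _ (fun x _ => kG x)).
exact: (@fubini_tonelli _ _ _ _ _ (sigma_finite_lebesgue n) nu k).
Qed.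

Lemma measurable_weighted_moment :
  measurable_fun (@sphere R n : set (borelV R n)) (fun theta =>
    (\int[lebesgue R n]_(x in A) (`|dot x theta| `^ p * h x)%:E)%E).
Proof.
apply/(measurable_restrictT _ (@measurable_sphere n)).
rewrite -(funext kG).
exact: (@measurable_fun_fubini_tonelli_G _ _ _ _ _ (sigma_finite_lebesgue n) k).
Qed.

Lemma measurable_weighted_pow_norm :
  measurable_fun A (fun x => N x `^ p * h x).
Proof.
apply/measurable_EFinP/(measurable_restrictT _ mA).
rewrite (_ : _ \_ A = fun x => \int[nu]_theta k (x, theta))%E; last first.
  by apply/funext => x; rewrite kF.
exact: measurable_fun_fubini_tonelli_F.
Qed.

End fix_weight.

(** Measurability of the gauge comes with the integral representation, as the
partial integral of a jointly measurable kernel. *)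
Lemma measurable_pow_norm :
  measurable_fun setT (fun x : lebesgueV R n => N x `^ p).
Proof.
have := @measurable_weighted_pow_norm (cst 1) setT (measurable_cst _)
  (fun=> ler01) measurableT.
by under eq_fun do rewrite mulr1.
Qed.

(** Integrating the directional hypothesis against [nu] compares the integrals
of [N ^ p] over [K] and [M]; over [M] the factor [N ^ p] is at most 1. *)
Lemma weighted_moment_le (f g : lebesgueV R n -> R)
    (K M : set (lebesgueV R n)) :
  0 < p -> measurable K -> measurable M ->
  measurable_fun setT f -> measurable_fun setT g ->
  (forall x, 0 <= f x) -> (forall x, 0 <= g x) ->
  (forall xi : 'rV[R]_n, sphere xi ->
    (\int[lebesgue R n]_(x in K) (`|dot x xi| `^ p * g x)%:E <=
     \int[lebesgue R n]_(x in M) (`|dot x xi| `^ p * f x)%:E)%E) ->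
  (forall x, M x -> N x <= 1) ->
  (\int[lebesgue R n]_(x in K) (N x `^ p * g x)%:E <=
   \int[lebesgue R n]_(x in M) (f x)%:E)%E.
Proof.
move=> p0 mK mM mf mg f0 g0 KM N1.
apply: (@le_trans _ _ (\int[lebesgue R n]_(x in M) (N x `^ p * f x)%:E)%E).
  rewrite !integral_pow_norm_exchange//; apply: ge0_le_integral.
  - exact: measurable_sphere.
  - move=> x _; apply: integral_ge0 => y _.
    by rewrite lee_fin mulr_ge0// powR_ge0.
  - exact: measurable_weighted_moment.
  - exact: measurable_weighted_moment.
  - exact: KM.
apply: ge0_le_integral; first exact: mM.
- by move=> x _; rewrite lee_fin mulr_ge0// powR_ge0.
- by apply/measurable_EFinP; exact: measurable_weighted_pow_norm.
- by apply/measurable_EFinP; exact: measurable_funTS.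
move=> x Mx; rewrite lee_fin ler_piMl//.
by have := ge0_ler_powR (ltW p0) (N0 x) ler01 (N1 x Mx); rewrite powR1.
Qed.

End moments.
End moment_exchange.

(** * Volumes of closed sets and gauges of symmetric convex bodies *)

Section volumes_and_gauges.
Context {R : realType}.

Lemma measurable_closed_borelV n (A : set 'rV[R]_n) : closed A ->
  measurable (A : set (borelV R n)).
Proof.
move=> cA; rewrite -[X in measurable X]setCK; apply: measurableC.
by apply: sub_sigma_algebra; exact: closed_openC.
Qed.

Lemma measurable_closed_lebesgueV n (A : set 'rV[R]_n) : closed A ->
  measurable (A : set (lebesgueV R n)).
Proof.
move=> cA; apply: measurable_borel_lebesgueV; exact: measurable_closed_borelV.
Qed.

Lemma lebesgue_bounded_lty n (A : set 'rV[R]_n) : closed A -> bounded_set A ->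
  (lebesgue R n A < +oo)%E.
Proof.
move=> cA /bounded_sub_cube[r r0 Ar].
have h : (lebesgue R n A <= lebesgue R n (cube n r))%E.
  apply: le_measure => //; rewrite inE.
    exact: measurable_closed_lebesgueV.
  by apply: measurable_borel_lebesgueV; exact: measurable_cube.
apply: (le_lt_trans h); rewrite lebesgue_borelE ?borel_lebesgue_cube ?ltry//.
exact: measurable_cube.
Qed.

Lemma lebesgue_interior_gt0 n (A : set 'rV[R]_n) : closed A -> interior A 0 ->
  (0 < lebesgue R n A)%E.
Proof.
move=> cA /nbhs_ballP[e /= e0 eA].
have e20 : 0 < e / 2 by rewrite divr_gt0.
have h : (0 < lebesgue R n (cube n (e / 2)))%E.
  rewrite lebesgue_borelE; last exact: measurable_cube.
  by rewrite borel_lebesgue_cube ?ltW// lte_fin exprn_gt0// mulr_gt0.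
apply: (lt_le_trans h); apply: le_measure => //; rewrite ?inE; last first.
- move=> x xe; apply: eA; split => // i j.
  rewrite mxE (ord1 i) -ball_normE/= sub0r normrN.
  by have := xe j; rewrite /= in_itv/= -ler_norml; lra.
- exact: measurable_closed_lebesgueV.
- by apply: measurable_borel_lebesgueV; exact: measurable_cube.
Qed.

Lemma lebesgue_dilation n (c : R) (A : set 'rV[R]_n) : 0 < c -> closed A ->
  ((c ^+ n)%:E * lebesgue R n (( *:%R c) @^-1` A) = lebesgue R n A)%E.
Proof.
move=> c0 cA; have mA := measurable_closed_borelV cA.
rewrite !lebesgue_borelE//; first exact: borel_lebesgue_dilation.
by rewrite -[X in measurable X]setTI; exact: measurable_scale.
Qed.

(** The hyperplane is a box with one side reduced to a point. *)
Lemma lebesgue_hyperplane n (i : 'I_n) :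
  lebesgue R n [set x : 'rV[R]_n | x ord0 i = 0] = 0%E /\
  measurable ([set x | (x : 'rV[R]_n) ord0 i = 0] : set (lebesgueV R n)).
Proof.
pose A (j : 'I_n) : set R := if j == i then [set 0] else setT.
have cA j : closed (A j).
  by rewrite /A; case: ifP => _; [exact: closed_eq|exact: closedT].
have -> : [set x : 'rV[R]_n | x ord0 i = 0] =
    [set x | forall j, A j (x ord0 j)].
  apply/seteqP; split => x /=; last by move=> /(_ i); rewrite /A eqxx.
  by move=> x0 j; rewrite /A; case: ifP => [/eqP->|].
have mB := @measurable_box R n A cA.
split; last exact: measurable_borel_lebesgueV.
rewrite lebesgue_borelE// borel_lebesgue_box// (bigD1 i)//=.
by rewrite {1}/A eqxx lebesgue_measure_set1 mul0e.
Qed.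

Section gauge.
Variables (n : nat) (D : set 'rV[R]_n).

Lemma minkowski_functional_ge0 x : 0 <= minkowski_functional D x.
Proof.
rewrite /minkowski_functional; set E := (X in inf X).
have [->|/set0P En] := eqVneq E set0; first by rewrite inf0.
by apply: lb_le_inf => // a [].
Qed.

Lemma minkowski_functional_le1 x : D x -> minkowski_functional D x <= 1.
Proof.
move=> Dx; apply: ge_inf; first by exists 0 => a [].
by split => //; exists x => //; rewrite scale1r.
Qed.

Hypotheses (symD : origin_symmetric D) (convD : convex_set D)
  (intD : interior D !=set0).

Lemma convex_set_combination x y (t : R) : D x -> D y -> 0 <= t <= 1 ->
  D (t *: x + (1 - t) *: y).
Proof.
move=> Dx Dy /andP[t0 t1].
have t01 : Itv.spec (@Itv.num_sem R) (Itv.Real `[0%Z, 1%Z]) t.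
  by rewrite /Itv.spec/= /Itv.num_sem/= ger0_real// in_itv/= t0 t1.
have := @convD x y (Itv.mk t01); rewrite !inE; exact.
Qed.

Lemma symmetric_convex_scale x (t : R) : D x -> 0 <= t <= 1 -> D (t *: x).
Proof.
move=> Dx /andP[t0 t1].
(* [t *: x] lies on the segment from [- x] to [x] *)
have -> : t *: x = ((t + 1) / 2) *: x + (1 - (t + 1) / 2) *: (- x).
  rewrite scalerN -scaleNr -scalerDl; congr (_ *: _); lra.
apply: convex_set_combination => //; first exact: symD.
by apply/andP; split; lra.
Qed.

(** The gauge is an infimum, and the infimum of the empty set is 0 by
convention; this lemma excludes that case.
If [D] contains [x0] and [x0 + t *: x], it contains [- x0] by symmetry and the
midpoint [(t / 2) *: x] by convexity. *)
Lemma gauge_absorbing x : exists a y, [/\ 0 <= a, D y & a *: y = x].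
Proof.
have [x0 /nbhs_ballP[e /= e0 x0e]] := intD.
have Dx0 : D x0 by apply: x0e; exact: ballxx.
have x1 : 0 < `|x| + 1 by rewrite ltr_wpDl.
pose t := e / (`|x| + 1); have t0 : 0 < t by rewrite divr_gt0.
have Dt : D (x0 + t *: x).
  apply: x0e; rewrite -ball_normE /= opprD addrA subrr sub0r normrN normrZ.
  by rewrite gtr0_norm// /t mulrAC ltr_pdivrMr// ltr_pM2l// ltrDl.
exists (2 / t), ((t / 2) *: x); split.
- by rewrite divr_ge0// ltW.
- have -> : (t / 2) *: x = 2^-1 *: (x0 + t *: x) + (1 - 2^-1) *: (- x0).
    have -> : 1 - 2^-1 = 2^-1 :> R by lra.
    by rewrite -scalerDr addrAC subrr add0r scalerA mulrC.
  apply: convex_set_combination => //; first exact: symD.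
  by apply/andP; split; lra.
- by rewrite scalerA mulrA divfK ?gt_eqF// divff ?scale1r.
Qed.

Lemma minkowski_functional_lt (r : R) x :
  0 < r -> minkowski_functional D x < r -> D (r^-1 *: x).
Proof.
move=> r0 /inf_lt[].
  have [a [y [a0 Dy ayx]]] := gauge_absorbing x.
  by exists a; split => //; exists y.
move=> a [a0 [y Dy <-]] ar; rewrite scalerA.
apply: symmetric_convex_scale => //.
by rewrite mulrC divr_ge0 ?(ltW r0)//= ler_pdivrMr// mul1r ltW.
Qed.

End gauge.

End volumes_and_gauges.

(** * The inequality for one body of the class *)

Section bound_for_one_body.
Context {R : realType}.
Variables (n : nat) (p : R).
Hypotheses (n0 : (0 < n)%N) (p0 : 0 < p).

Let nR0 : 0 < n%:R :> R. Proof. by rewrite ltr0n. Qed.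

Section one_body.
Variables (D : set 'rV[R]_n).
Hypothesis LpD : Lp_ball p D.

Let symD : origin_symmetric D. Proof. by case: LpD. Qed.
Let compD : compact D. Proof. by case: LpD => _ []. Qed.
Let convD : convex_set D. Proof. by case: LpD => _ []. Qed.
Let intD : interior D !=set0. Proof. by case: LpD => _ []. Qed.

Lemma Lp_ball_closed : closed D.
Proof. by apply: compact_closed => //; exact: norm_hausdorff. Qed.

Lemma lebesgue_Lp_ball_lty : (lebesgue R n D < +oo)%E.
Proof.
apply: lebesgue_bounded_lty; first exact: Lp_ball_closed.
exact: compact_bounded.
Qed.

Let N := minkowski_functional D.
Let V := fine (lebesgue R n D).

Let VE : lebesgue R n D = V%:E.
Proof. by rewrite /V fineK// ge0_fin_numE ?lebesgue_Lp_ball_lty. Qed.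

Lemma measurable_minkowski_pow :
  measurable_fun setT (fun x : lebesgueV R n => N x `^ p).
Proof. by case: LpD => _ _ [nu _ NE]; exact: (measurable_pow_norm NE). Qed.

(** With [r = s ^ (1 / p)], the sublevel set is {N < r}, which lies in the
dilate of [D] by [r]. *)
Lemma lebesgue_sublevel_le (s : R) : 0 < s ->
  (lebesgue R n [set x | (N x `^ p < s)%R] <= (V * s `^ (n%:R / p))%:E)%E.
Proof.
move=> s0; set r := s `^ p^-1.
have r0 : 0 < r by exact: powR_gt0.
have mD := measurable_closed_borelV Lp_ball_closed.
apply: (@le_trans _ _ (lebesgue R n (( *:%R r^-1) @^-1` D))).
  apply: le_measure => //; rewrite ?inE.
  - apply: measurable_bool_set.
    exact: measurable_fun_ltr measurable_minkowski_pow (measurable_cst _).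
  - apply: measurable_borel_lebesgueV; rewrite -[X in measurable X]setTI.
    exact: measurable_scale.
  move=> x /= Nxs; apply: (minkowski_functional_lt symD convD intD r0).
  rewrite ltNge; apply/negP => rN; move: Nxs; apply/negP; rewrite -leNgt.
  have := ge0_ler_powR (ltW p0) (ltW r0) (minkowski_functional_ge0 D x) rN.
  by rewrite /r -powRrM mulVf ?gt_eqF// powRr1// ltW.
have rE : s `^ (n%:R / p) = r ^+ n by rewrite mulrC powRrM powR_mulrn// ltW.
have rV0 : 0 < r^-1 by rewrite invr_gt0.
have := lebesgue_dilation rV0 Lp_ball_closed.
rewrite VE; case: (lebesgue R n _) => [v| |].
- move=> -[]; rewrite lee_fin => <-.
  by rewrite rE mulrAC -exprMn mulVf ?gt_eqF// expr1n mul1r.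
- by rewrite gt0_muley// lte_fin exprn_gt0.
- by move=> _; exact: leNye.
Qed.

Variables (f g : 'rV[R]_n -> R) (K M : set 'rV[R]_n) (I : R).
Hypotheses (mf : measurable_fun [set: lebesgueV R n] f)
    (mg : measurable_fun [set: lebesgueV R n] g)
    (f0 : forall x, 0 <= f x) (g0 : forall x, 0 <= g x)
    (g1 : {ae lebesgue R n, forall x, g x <= 1}).
Hypotheses (mK : measurable (K : set (lebesgueV R n)))
  (mM : measurable (M : set (lebesgueV R n))).
Hypothesis hKM : forall xi : 'rV[R]_n, sphere xi ->
      (\int[lebesgue R n]_(x in K) (`|dot x xi| `^ p * g x)%:E <=
       \int[lebesgue R n]_(x in M) (`|dot x xi| `^ p * f x)%:E)%E.
Hypotheses (MD : M `<=` D) (V0 : (0 < lebesgue R n D)%E).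
Hypothesis IE : (\int[lebesgue R n]_(x in K) (g x)%:E = I%:E)%E.

(** The upper bound [int_K N^p g <= int_M f] meets the layer-cake lower bound
for [phi = N^p] and [a = n / p].  The level [t] is the one at which [V * t ^ a]
equals the mass [I], that is, at which {N^p < t} is the dilate of [D] of volume
[I]; the lower bound then equals [t * I * (a / (a + 1))], and
[a / (a + 1) = n / (n + p)] is the constant of the theorem. *)
Lemma Lp_ball_bound :
  ((I `^ ((n%:R + p) / n%:R))%:E <=
   ((n%:R + p) / n%:R * V `^ (p / n%:R))%:E *
   \int[lebesgue R n]_(x in M) (f x)%:E)%E.
Proof.
have np0 : 0 < n%:R + p by rewrite addr_gt0.
have F0 : (0 <= \int[lebesgue R n]_(x in M) (f x)%:E)%E.
  by apply: integral_ge0 => x _; rewrite lee_fin.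
have I0 : 0 <= I.
  by rewrite -lee_fin -IE; apply: integral_ge0 => x _; rewrite lee_fin.
have Vgt0 : 0 < V by rewrite -lte_fin -VE.
move: I0; rewrite le_eqVlt => /predU1P[<-|I0].
  rewrite powR0 ?gt_eqF ?divr_gt0// mule_ge0// lee_fin.
  by rewrite mulr_ge0 ?powR_ge0// divr_ge0// ltW.
set t := (I / V) `^ (p / n%:R); set a := n%:R / p.
have t0 : 0 < t by rewrite powR_gt0// divr_gt0.
have a0 : 0 < a by rewrite divr_gt0.
have W_F : (\int[lebesgue R n]_(x in K) (N x `^ p * g x)%:E <=
   \int[lebesgue R n]_(x in M) (f x)%:E)%E.
  case: LpD => _ _ [nu _ NE]; apply: (weighted_moment_le _ NE) => //.
  - exact: minkowski_functional_ge0.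
  - by move=> x /MD; exact: minkowski_functional_le1.
have := @layer_cake_lower_bound _ _ _ (sigma_finite_lebesgue n)
  (fun x => N x `^ p) g K V a t measurable_minkowski_pow mg mK
  (fun x => powR_ge0 _ _) g0 g1 (ltW Vgt0) a0 t0 lebesgue_sublevel_le.
rewrite IE.
have -> : V * (t `^ (a + 1) / (a + 1)) = t * I / (a + 1).
  rewrite powRD ?gt_eqF ?addr_gt0 ?implybT// powRr1 ?ltW// /t -powRrM.
  have -> : p / n%:R * a = 1 by rewrite /a mulrA divfK ?divff ?gt_eqF.
  rewrite powRr1 ?divr_ge0 ?ltW// -/t; field.
  by rewrite !gt_eqF// addr_gt0.
move=> h.
have {}h : ((t * I * (a / (a + 1)))%:E <=
    \int[lebesgue R n]_(x in M) (f x)%:E)%E.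
  have -> : t * I * (a / (a + 1)) = t * I - t * I / (a + 1).
    by field; rewrite gt_eqF// addr_gt0.
  rewrite EFinB leeBlDr//; apply: le_trans (leeD2r _ W_F).
  exact: h.
have -> : I `^ ((n%:R + p) / n%:R) =
    (n%:R + p) / n%:R * V `^ (p / n%:R) * (t * I * (a / (a + 1))).
  have -> : I `^ ((n%:R + p) / n%:R) = I * (t * V `^ (p / n%:R)).
    rewrite /t -powRM ?divr_ge0 ?ltW// divfK ?gt_eqF//.
    rewrite -{2}(powRr1 (ltW I0)) -powRD ?gt_eqF ?addr_gt0 ?divr_gt0//.
    by congr (_ `^ _); field; rewrite gt_eqF.
  have key (v w q m : R) : 0 < q -> 0 < m ->
      I * (w * v) = (m + q) / m * v * (w * I * (m / q / (m / q + 1))).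
    move=> q0 m0; field.
    by rewrite !gt_eqF// addr_gt0.
  exact: key.
rewrite EFinM lee_wpmul2l// lee_fin.
by rewrite mulr_ge0 ?powR_ge0// divr_ge0// ltW.
Qed.
End one_body.
End bound_for_one_body.

(** * The case of a vanishing right-hand side *)

Section vanishing_moment.
Context {R : realType} (n : nat).
Local Notation mu := (lebesgue R n).

Lemma ge0_integral_eq0_ae (A : set (lebesgueV R n)) (h : lebesgueV R n -> R) :
  measurable A -> measurable_fun setT h -> (forall x, 0 <= h x) ->
  (\int[mu]_(x in A) (h x)%:E = 0)%E <-> ae_eq mu A (EFin \o h) (cst 0%E).
Proof.
move=> mA mh h0; rewrite -ae_eq_integral_abs//; last first.
  by apply/measurable_EFinP; exact: measurable_funTS.
by under [in X in _ <-> X]eq_integral do rewrite /= ger0_norm//.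
Qed.

Lemma dot_delta (i : 'I_n) (x : 'rV[R]_n) : dot x (delta_mx ord0 i) = x ord0 i.
Proof.
rewrite /dot (bigD1 i)//= big1 ?addr0; first by rewrite mxE !eqxx mulr1.
by move=> j ji; rewrite mxE eqxx (negbTE ji) mulr0.
Qed.

Lemma sphere_delta (i : 'I_n) : sphere (delta_mx ord0 i : 'rV[R]_n).
Proof. by rewrite /sphere/= dot_delta mxE !eqxx. Qed.

Lemma measurable_pow_coord (p : R) (i : 'I_n) :
  measurable_fun setT (fun x : lebesgueV R n =>
    `|dot (x : 'rV[R]_n) (delta_mx ord0 i)| `^ p).
Proof.
under eq_fun do rewrite dot_delta.
apply: (measurableT_comp (measurable_powR _)).
apply: (measurableT_comp (@normr_measurable _ _)).
exact: (measurableT_comp (measurable_coord i)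
  (@measurable_lebesgueV_borel R n)).
Qed.

(** If [f] vanishes almost everywhere on [M], then so does [|x_i|^p g] on [K];
as the hyperplane [x_i = 0] is a null set, [g] itself vanishes almost everywhere
on [K]. *)
Lemma integral_eq0_of_coord_moment (p : R) (i : 'I_n)
    (K M : set (lebesgueV R n)) (f g : lebesgueV R n -> R) :
  measurable K -> measurable M ->
  measurable_fun setT f -> measurable_fun setT g ->
  (forall x, 0 <= f x) -> (forall x, 0 <= g x) ->
  (\int[mu]_(x in K) (`|dot x (delta_mx ord0 i)| `^ p * g x)%:E <=
   \int[mu]_(x in M) (`|dot x (delta_mx ord0 i)| `^ p * f x)%:E)%E ->
  (\int[mu]_(x in M) (f x)%:E = 0)%E -> (\int[mu]_(x in K) (g x)%:E = 0)%E.
Proof.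
move=> mK mM mf mg f0 g0 + intf0.
have mprod h : measurable_fun setT h -> measurable_fun setT
    (fun x : lebesgueV R n =>
      `|dot (x : 'rV[R]_n) (delta_mx ord0 i)| `^ p * h x).
  by move=> mh; exact: (measurable_funM (measurable_pow_coord p i) mh).
have prod0 h : (forall x, 0 <= h x) ->
    forall x : lebesgueV R n,
      0 <= `|dot (x : 'rV[R]_n) (delta_mx ord0 i)| `^ p * h x.
  by move=> h0 x; rewrite mulr_ge0 ?powR_ge0.
have /(ge0_integral_eq0_ae mM (mprod _ mf) (prod0 _ f0)) -> :
    ae_eq mu M (EFin \o (fun x : lebesgueV R n =>
      `|dot (x : 'rV[R]_n) (delta_mx ord0 i)| `^ p * f x)) (cst 0%E).
  move/(ge0_integral_eq0_ae mM mf f0): intf0.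
  by apply: filterS => x fx0 /fx0/= -[->]; rewrite mulr0.
move=> le0.
have /(ge0_integral_eq0_ae mK (mprod _ mg) (prod0 _ g0)) pg0 :
    (\int[mu]_(x in K) (`|dot x (delta_mx ord0 i)| `^ p * g x)%:E = 0)%E.
  apply/eqP; rewrite eq_le le0 integral_ge0// => x _.
  by rewrite lee_fin prod0.
apply/(ge0_integral_eq0_ae mK mg g0).
have hyp : {ae mu, forall x : 'rV[R]_n, x ord0 i != 0}.
  exists [set x : 'rV[R]_n | x ord0 i = 0].
  have [? ?] := @lebesgue_hyperplane R n i; split => //.
  by move=> x /= /negP; rewrite negbK => /eqP.
apply: filterS2 pg0 hyp => x gx0 xi0 /gx0 /= -[] /eqP.
rewrite mulf_eq0 dot_delta powR_eq0 normr_eq0 (negbTE xi0)/= => /eqP ->//.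
Qed.

End vanishing_moment.

(** * The infimum over the class *)

Lemma Lnorm_oo_ae_le d (T : measurableType d) (R : realType)
    (mu : {measure set T -> \bar R}) (g : T -> R) :
  ('N[mu]_(+oo)[EFin \o g] = 1)%E -> {ae mu, forall x, g x <= 1}.
Proof.
rewrite unlock; case: ifPn => [_ h|_ /eqP]; last by rewrite eq_sym onee_eq0.
have := ess_sup_ge mu (abse \o (EFin \o g)); rewrite h.
apply: filterS => x /=; rewrite lee_fin; apply: le_trans; exact: ler_norm.
Qed.

Lemma integral_ae_le1 d (T : measurableType d) (R : realType)
    (mu : {measure set T -> \bar R}) (K : set T) (g : T -> R) :
  measurable K -> measurable_fun setT g -> (forall x, 0 <= g x) ->
  {ae mu, forall x, g x <= 1} -> (\int[mu]_(x in K) (g x)%:E <= mu K)%E.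
Proof.
move=> mK mg g0 g1; rewrite -[leRHS]mul1e -integral_cst//.
apply: ae_ge0_le_integral => //.
- by move=> x _; rewrite lee_fin.
- by apply/measurable_EFinP; exact: measurable_funTS.
- by apply: filterS g1 => x gx1 _; rewrite lee_fin.
Qed.

Section outer_volume_ratio.
Context {R : realType} (n : nat) (p : R) (M : set 'rV[R]_n) (m : R).
Hypotheses (cM : closed M) (m0 : 0 < m) (mE : lebesgue R n M = m%:E).

Lemma Lp_ball_volume_ge (D : set 'rV[R]_n) :
  M `<=` D -> Lp_ball p D -> m <= fine (lebesgue R n D).
Proof.
move=> MD LD; rewrite -lee_fin fineK ?ge0_fin_numE ?(lebesgue_Lp_ball_lty LD)//.
rewrite -mE le_measure ?inE//; first exact: measurable_closed_lebesgueV.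
exact/measurable_closed_lebesgueV/(Lp_ball_closed LD).
Qed.

(** All volumes involved are finite, so that a lower bound of [d_ovr] can be
checked on real volume ratios. *)
Lemma le_d_ovr (c : R) :
  (forall D, M `<=` D -> Lp_ball p D ->
    c <= (fine (lebesgue R n D) / m) `^ n%:R^-1) ->
  (c%:E <= d_ovr M p)%E.
Proof.
move=> cD; apply: le_ereal_inf_tmp => _ [D [MD LD] <-].
have Doo := lebesgue_Lp_ball_lty LD.
rewrite mE inver gt_eqF// -(@fineK _ (lebesgue R n D)) ?ge0_fin_numE//.
by rewrite -EFinM poweR_EFin lee_fin cD.
Qed.

Lemma d_ovr_ge1 : (1 <= d_ovr M p)%E.
Proof.
apply: le_d_ovr => D MD LD.
apply: (@le_trans _ _ (1 `^ n%:R^-1)); first by rewrite powR1.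
have mV := Lp_ball_volume_ge MD LD.
apply: ge0_ler_powR; rewrite ?nnegrE ?invr_ge0//.
  by rewrite divr_ge0// ltW// (lt_le_trans m0).
by rewrite ler_pdivlMr// mul1r.
Qed.

End outer_volume_ratio.

Theorem theorem2 (R : realType) (n : nat) (hn : (0 < n)%N)
    (K M : set 'rV[R]_n) (hK : star_body K) (hM : star_body M)
    (p : R) (hp : 0 < p)
    (f g : 'rV[R]_n -> R)
    (mf : measurable_fun [set: lebesgueV R n] f)
    (mg : measurable_fun [set: lebesgueV R n] g)
    (f_ge0 : forall x, 0 <= f x) (g_ge0 : forall x, 0 <= g x)
    (g_norm : ('N[lebesgue R n]_(+oo)[EFin \o g] = (g 0)%:E)%E) (g0 : g 0 = 1)
    (hKM : forall xi : 'rV[R]_n, sphere xi ->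
      (\int[lebesgue R n]_(x in K) (`|dot x xi| `^ p * g x)%:E <=
       \int[lebesgue R n]_(x in M) (`|dot x xi| `^ p * f x)%:E)%E) :
  ((\int[lebesgue R n]_(x in K) (g x)%:E) `^ ((n%:R + p) / n%:R) <=
   ((n%:R + p) / n%:R)%:E * d_ovr M p `^ p * lebesgue R n M `^ (p / n%:R) *
   \int[lebesgue R n]_(x in M) (f x)%:E)%E.
Proof.
case: hK => -[cK bK] _ _ _; case: hM => -[cM bM] _ intM _.
have mK := measurable_closed_lebesgueV cK.
have mM := measurable_closed_lebesgueV cM.
have g1 : {ae lebesgue R n, forall x, g x <= 1}.
  by apply: Lnorm_oo_ae_le; rewrite g_norm g0.
have nR0 : 0 < n%:R :> R by rewrite ltr0n.
have np0 : 0 < n%:R + p by rewrite addr_gt0.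
have c0 : 0 < (n%:R + p) / n%:R :> R by rewrite divr_gt0.
set F := (\int[lebesgue R n]_(x in M) (f x)%:E)%E.
have F0 : (0 <= F)%E by apply: integral_ge0 => x _; rewrite lee_fin.
have J0 : (0 <= \int[lebesgue R n]_(x in K) (g x)%:E)%E.
  by apply: integral_ge0 => x _; rewrite lee_fin.
have Joo : (\int[lebesgue R n]_(x in K) (g x)%:E < +oo)%E.
  apply: le_lt_trans (lebesgue_bounded_lty cK bK).
  exact: integral_ae_le1.
have [Fz|Fnz] := eqVneq F 0%E.
  have -> : (\int[lebesgue R n]_(x in K) (g x)%:E = 0)%E.
    have h := hKM _ (sphere_delta (Ordinal hn)).
    exact: (integral_eq0_of_coord_moment mK mM mf mg f_ge0 g_ge0 h Fz).
  by rewrite Fz mule0 poweR0r// gt_eqF.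
have Fgt0 : (0 < F)%E by rewrite lt_def Fnz.
move: J0 Joo hKM; set J := (\int[lebesgue R n]_(x in K) _)%E.
case EJ : J => [I| |]// I0 _ hKM'.
have M0 := lebesgue_interior_gt0 cM intM.
have Moo := lebesgue_bounded_lty cM bM.
have [m mE] : exists m, lebesgue R n M = m%:E.
  by exists (fine (lebesgue R n M)); rewrite fineK// ge0_fin_numE.
have m0 : 0 < m by rewrite -lte_fin -mE.
have d1 : (1 <= d_ovr M p)%E by exact: d_ovr_ge1 mE.
have dp0 : (0 < d_ovr M p `^ p)%E by rewrite poweR_gt0// (lt_le_trans _ d1).
move: F0 Fgt0 Fnz; rewrite -/F.
case EF : F => [r| |]// _ r0 _; last first.
  by rewrite gt0_muley ?leey// mE !mule_gt0// poweR_gt0.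
rewrite lte_fin in r0.
rewrite mE !poweR_EFin.
set A := ((n%:R + p) / n%:R) * m `^ (p / n%:R) * r.
have A0 : 0 < A by rewrite mulr_gt0// mulr_gt0// powR_gt0.
set B := I `^ ((n%:R + p) / n%:R).
have B0 : 0 <= B by exact: powR_ge0.
have -> : (((n%:R + p) / n%:R)%:E * d_ovr M p `^ p *
    (m `^ (p / n%:R))%:E * r%:E = A%:E * d_ovr M p `^ p)%E.
  by rewrite (muleC _ (d_ovr M p `^ p)%E) -!muleA muleC -!EFinM !mulrA.
(* the goal [B <= A * d_ovr M p ^ p] solved for [d_ovr M p], a form in which it
   can be checked body by body *)
have hd : (((B / A) `^ p^-1)%:E <= d_ovr M p)%E.
  apply: (le_d_ovr m0 mE) => D MD LD.
  have Vm := Lp_ball_volume_ge cM mE MD LD.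
  have D0 : (0 < lebesgue R n D)%E.
    rewrite -(@fineK _ (lebesgue R n D)) ?ge0_fin_numE//.
      by rewrite lte_fin (lt_le_trans m0).
    exact: lebesgue_Lp_ball_lty LD.
  have := Lp_ball_bound hn hp LD mf mg f_ge0 g_ge0 g1 mK mM hKM' MD D0 EJ.
  rewrite -/F EF -/B -EFinM lee_fin; set V := fine _ => BV.
  have V0 : 0 <= V by rewrite fine_ge0.
  have -> : (V / m) `^ n%:R^-1 = ((V / m) `^ (p / n%:R)) `^ p^-1.
    rewrite -powRrM; congr (_ `^ _).
    by field; rewrite !gt_eqF.
  apply: ge0_ler_powR;
    rewrite ?nnegrE ?invr_ge0 ?powR_ge0 ?divr_ge0 ?(ltW A0) ?(ltW hp)//.
  rewrite ler_pdivrMr//; apply: le_trans BV _.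
  have -> : V `^ (p / n%:R) = (V / m) `^ (p / n%:R) * m `^ (p / n%:R).
    by rewrite -powRM ?divr_ge0 ?(ltW m0)// divfK// gt_eqF.
  by rewrite /A le_eqVlt; apply/orP; left; apply/eqP; ring.
rewrite -lee_pdivrMl// -EFinM.
have -> : A^-1 * B = (B / A) `^ p^-1 `^ p.
  by rewrite -powRrM mulVf ?gt_eqF// powRr1 ?divr_ge0// ?ltW// mulrC.
rewrite -poweR_EFin gt0_ler_poweR ?(ltW hp)//.
- by rewrite in_itv/= leey lee_fin powR_ge0.
- by rewrite in_itv/= leey (le_trans _ d1).
Qed.
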